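(* Let $P\subset\mathbb{R}^n$ be a deeply monotone polytope. Then $P$ satisfies the strong Ewald condition and the star Ewald condition (and, consequently, also the weak Ewald condition).
   Context: An $n$-dimensional polytope $P\subset\mathbb{R}^n$ is smooth if it is simple (exactly $n$ edges at each vertex), rational (rational edge directions), and the primitive edge-direction vectors at each vertex form a basis of $\mathbb{Z}^n$. It is a lattice polytope if its vertices lie in $\mathbb{Z}^n$. A lattice polytope with the origin in its interior is reflexive if every facet-defining inequality is of the form $u_F\cdot x\le 1$ with $u_F\in\mathbb{Z}^n$ the primitive exterior normal vector of the facet $F$. A polytope is monotone if it is smooth and reflexive. Let $v$ be a vertex of a smooth lattice polytope $P$ and $u_1,\dots,u_n$ the primitive edge vectors at $v$ (pointing from $v$ along the edges). The corner parallelepiped of $P$ at $v$ is $\{v+\sum_{i=1}^n\lambda_iu_i : \lambda_i\in[0,1]\ \forall i\}$. $P$ is deeply smooth if it contains the corner parallelepipeds at all its vertices, and deeply monotone if it is deeply smooth and monotone. The Ewald set of $P$ is $\mathcal{E}(P):=\mathbb{Z}^n\cap P\cap(-P)$. A unimodular basis of $\mathbb{Z}^n$ is a $\mathbb{Z}$-basis of $\mathbb{Z}^n$. For a face $f$ of $P$, let $\operatorname{Star}(f)$ be the union of all facets of $P$ containing $f$, $\operatorname{star}(f)$ the union of all ridges (faces of codimension two) of $P$ containing $f$, and $\operatorname{Star}^*(f)=\operatorname{Star}(f)\setminus\operatorname{star}(f)$. For $P$ with the origin in its interior: - weak Ewald condition: $\mathcal{E}(P)$ contains a unimodular basis of $\mathbb{Z}^n$;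 - strong Ewald condition: for each facet $F$ of $P$ the set $\mathcal{E}(P)\cap F$ contains a unimodular basis of $\mathbb{Z}^n$; - star Ewald condition: for every nonempty proper face $f$ of $P$ there exists $\lambda\in\mathcal{E}(P)$ with $\lambda\in\operatorname{Star}^*(f)$ and $-\lambda\notin\operatorname{Star}(f)$. *)

(* Defs.v *)
From mathcomp Require Import all_boot all_order all_algebra.
From mathcomp Require Import boolp classical_sets functions cardinality.
From mathcomp Require Import reals topology normedtype.

Set Implicit Arguments.
Unset Strict Implicit.
Unset Printing Implicit Defensive.

Import Order.TTheory GRing.Theory Num.Theory.
Import numFieldNormedType.Exports.

Local Open Scope classical_set_scope.
Local Open Scope card_scope.
Local Open Scope ring_scope.

Section Lattice.
Variables (R : realType) (n : nat).

Definition zvec (w : 'rV[int]_n) : 'rV[R]_n := map_mx intr w.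

Definition Zlattice : set 'rV[R]_n := range zvec.

Definition dotv (u x : 'rV[R]_n) : R := \sum_(i < n) u 0 i * x 0 i.

End Lattice.

Definition primitive_zvec (n : nat) (u : 'rV[int]_n) : Prop :=
  \big[gcdn/0%N]_(i < n) absz (u 0 i) = 1%N.

Definition Zbasis (n : nat) (B : 'M[int]_n) : Prop :=
  forall w : 'rV[int]_n, exists! c : 'rV[int]_n,
    w = \sum_(i < n) c 0 i *: row i B.

Section Polytopes.
Variables (R : realType) (n : nat).
Implicit Types (A P F f : set 'rV[R]_n) (v x : 'rV[R]_n).

Definition contains_Zbasis A : Prop :=
  exists B : 'M[int]_n, Zbasis B /\ forall i, A (zvec R (row i B)).

Definition convex_hull_of (m : nat) (V : 'M[R]_(m, n)) : set 'rV[R]_n :=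
  [set x | exists c : 'I_m -> R,
     [/\ forall i, 0 <= c i, \sum_(i < m) c i = 1
       & x = \sum_(i < m) c i *: row i V]].

(* A is nonempty of affine dimension d: p and the d points p + row i B are
   affinely independent points of A whose affine hull contains A. *)
Definition affdim A (d : nat) : Prop :=
  exists (p : 'rV[R]_n) (B : 'M[R]_(d, n)),
    [/\ A p, row_free B, forall i, A (p + row i B)
      & forall x, A x -> (x - p <= B)%MS].

Definition full_dim_polytope P : Prop :=
  (exists (m : nat) (V : 'M[R]_(m, n)), P = convex_hull_of V) /\ affdim P n.

(* u = 0 is allowed, so set0 and P itself are faces of P. *)
Definition face P F : Prop :=
  exists (u : 'rV[R]_n) (c : R),
    (forall x, P x -> dotv u x <= c) /\ F = [set x | P x /\ dotv u x = c].

Definition vertex P v : Prop := face P [set v].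
Definition edge P F : Prop := face P F /\ affdim F 1.
Definition facet P F : Prop :=
  face P F /\ exists2 d : nat, d.+1 = n & affdim F d.
Definition ridge P F : Prop :=
  face P F /\ exists2 d : nat, d.+2 = n & affdim F d.

Definition lattice_polytope P : Prop :=
  full_dim_polytope P /\ forall v, vertex P v -> Zlattice v.

Definition simple_polytope P : Prop :=
  full_dim_polytope P /\
  forall v, vertex P v -> [set F | edge P F /\ F v] #= `I_n.

Definition rational_edges P : Prop :=
  forall F, edge P F -> exists2 w : 'rV[int]_n, w != 0 &
    forall x y, F x -> F y -> exists t : R, y - x = t *: zvec R w.

Definition primitive_edge_vector P v (u : 'rV[int]_n) : Prop :=
  primitive_zvec u /\
  exists F, [/\ edge P F, F v & exists2 t : R, 0 < t & F (v + t *: zvec R u)].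

(* The rows of U list, without repetition, the primitive edge vectors at v. *)
Definition edge_frame P v (U : 'M[int]_n) : Prop :=
  injective (fun i => row i U) /\
  forall u, primitive_edge_vector P v u <-> exists i, u = row i U.

Definition smooth_polytope P : Prop :=
  [/\ simple_polytope P, rational_edges P
    & forall v, vertex P v ->
        exists U : 'M[int]_n, edge_frame P v U /\ Zbasis U].

(* u is the exterior normal since the inequality is valid on P. *)
Definition reflexive_polytope P : Prop :=
  [/\ lattice_polytope P, interior P 0
    & forall F, facet P F -> exists2 u : 'rV[int]_n, primitive_zvec u &
        (forall x, P x -> dotv (zvec R u) x <= 1) /\
        F = [set x | P x /\ dotv (zvec R u) x = 1]].

Definition monotone_polytope P : Prop :=
  smooth_polytope P /\ reflexive_polytope P.

(* The set does not depend on the ordering U of the edge vectors; for smooth P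
   and a vertex v of P, such a U exists. *)
Definition corner_parallelepiped P v : set 'rV[R]_n :=
  [set x | exists (U : 'M[int]_n) (l : 'I_n -> R),
     [/\ edge_frame P v U, forall i, 0 <= l i <= 1
       & x = v + \sum_(i < n) l i *: zvec R (row i U)]].

Definition deeply_smooth P : Prop :=
  [/\ smooth_polytope P, lattice_polytope P
    & forall v, vertex P v -> corner_parallelepiped P v `<=` P].

Definition deeply_monotone P : Prop := deeply_smooth P /\ monotone_polytope P.

Definition Ewald_set P : set 'rV[R]_n :=
  @Zlattice R n `&` P `&` [set x | P (- x)].

Definition Star P f : set 'rV[R]_n :=
  \bigcup_(F in [set F | facet P F /\ f `<=` F]) F.

Definition ridge_star P f : set 'rV[R]_n :=
  \bigcup_(F in [set F | ridge P F /\ f `<=` F]) F.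

Definition open_Star P f : set 'rV[R]_n := Star P f `\` ridge_star P f.

Definition weak_Ewald P : Prop := contains_Zbasis (Ewald_set P).

Definition strong_Ewald P : Prop :=
  forall F, facet P F -> contains_Zbasis (Ewald_set P `&` F).

Definition star_Ewald P : Prop :=
  forall f, face P f -> f !=set0 -> f <> P ->
    exists l, [/\ Ewald_set P l, open_Star P f l & ~ Star P f (- l)].

End Polytopes.

(* Main.v *)
Require Import Defs.
From mathcomp Require Import all_boot all_order all_algebra.
From mathcomp Require Import classical_sets reals.
From mathcomp Require Import boolp zify ring lra.

Set Implicit Arguments.
Unset Strict Implicit.
Unset Printing Implicit Defensive.

Import Order.TTheory GRing.Theory Num.Theory.
Local Open Scope classical_set_scope.
Local Open Scope ring_scope.

(** Fix a vertex [v] of [P], with primitive edge vectors [u_1, ..., u_n].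

    A polytope lies in the cone spanned by its edges at [v], since a linear
    functional that no edge at [v] decreases is minimal at [v]
    ([decreasing_edge], [polytope_in_corner]).  Hence the [i]-th coordinate in
    the basis [u] is minimal at [v], and its minimum set is a facet.
    Reflexivity says that this minimum is [-1] ([vertex_coord]).  So
    [v = - (u_1 + ... + u_n)], and the corner parallelepiped at [v] contains
    minus every partial sum of the [u_i] ([chart_corner]); in particular [- u_i]
    is in [P].  The far end of the edge [i] is a vertex with edge vector
    [- u_i], so the same argument there puts [u_i] in [P].  The edge vectors at
    any vertex are thus a lattice basis in the Ewald set: the weak condition.

    For the star condition take [v] in the face [f] and a coordinate [i] that is
    constantly [-1] on [f].  The point [- u_i] has coordinates [-1] at [i] and
    [0] elsewhere, so it lies in the [i]-th facet and in no smaller face through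
    [v], while [u_i] has no coordinate equal to [-1] and lies in no proper face
    through [v].

    For the strong condition, the facet is the [k]-th coordinate facet at one of
    its vertices.  It contains [- u_k], and it is enough to find for each
    [j != k] a sign [e] such that [- u_k + e u_j] is in the Ewald set.  At the
    far end of the edge [i] the edge vectors are [- u_i] and [u_j + a u_i] with
    integers [a] depending on [j] ([neighbour_edge]).  Comparing the corners at
    [v] and at the far ends of two of its edges produces the sign
    ([symmetric_pair]). *)

(** * Linear functionals and affine dimension *)

Section Functionals.
Variables (R : realType) (n : nat).
Implicit Types (u w x y : 'rV[R]_n).

Lemma dotvDr u x y : dotv u (x + y) = dotv u x + dotv u y.
Proof.
by rewrite -big_split; apply: eq_bigr => i _; rewrite mxE mulrDr.
Qed.

Lemma dotvZr a u x : dotv u (a *: x) = a * dotv u x.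
Proof. by rewrite big_distrr; apply: eq_bigr => i _; rewrite mxE mulrCA. Qed.

Lemma dotvNr u x : dotv u (- x) = - dotv u x.
Proof. by rewrite -scaleN1r dotvZr mulN1r. Qed.

Lemma dotvBr u x y : dotv u (x - y) = dotv u x - dotv u y.
Proof. by rewrite dotvDr dotvNr. Qed.

Lemma dotv0r u : dotv u 0 = 0.
Proof. by rewrite -(scale0r 0) dotvZr mul0r. Qed.

Lemma dotv_sumr I (r : seq I) (p : pred I) u (f : I -> 'rV[R]_n) :
  dotv u (\sum_(i <- r | p i) f i) = \sum_(i <- r | p i) dotv u (f i).
Proof. exact: (big_morph _ (dotvDr u) (dotv0r u)). Qed.

Lemma dotvC u x : dotv u x = dotv x u.
Proof. by apply: eq_bigr => i _; rewrite mulrC. Qed.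

Lemma dotvDl u w x : dotv (u + w) x = dotv u x + dotv w x.
Proof. by rewrite !(dotvC _ x) dotvDr. Qed.

Lemma dotvZl a u x : dotv (a *: u) x = a * dotv u x.
Proof. by rewrite !(dotvC _ x) dotvZr. Qed.

Lemma dotvNl u x : dotv (- u) x = - dotv u x.
Proof. by rewrite !(dotvC _ x) dotvNr. Qed.

Lemma dotv_gt0 x : x != 0 -> 0 < dotv x x.
Proof.
move=> /rV0Pn[i xi].
rewrite /dotv (bigD1 i) //= ltr_pwDl //.
  by rewrite -expr2 exprn_even_gt0.
by apply: sumr_ge0 => j _; rewrite -expr2 sqr_ge0.
Qed.

(** Used for perturbation: adding a small multiple of one functional to another
    keeps finitely many strict inequalities.  Division by [0] being [0], the sum
    in the bound ignores the indices where [a] vanishes. *)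
Lemma finite_domination (I : finType) (a b : I -> R) :
  (forall i, 0 <= a i) -> exists M : R, forall i, 0 < a i -> b i < M * a i.
Proof.
move=> a0; exists (1 + \sum_i `|b i| / a i) => i ai.
rewrite -ltr_pdivrMr // (bigD1 i) //=.
have h0 : 0 <= \sum_(j | j != i) `|b j| / a j.
  by apply: sumr_ge0 => j _; rewrite divr_ge0.
have : b i / a i <= `|b i| / a i by rewrite ler_pM2r ?invr_gt0 // ler_norm.
lra.
Qed.

(** Every linear programme over finitely many points has an optimal solution
    that is exposed.  Among the maximizers of [h] take one, [p k], of largest
    Euclidean norm: [x |-> dotv (p k) x] has its strict maximum over these
    points at [p k], because [2 (p k . y) = |p k|^2 + |y|^2 - |p k - y|^2].
    A large multiple of [h] then takes care of the other points. *)
Lemma exposed_maximizer (I : finType) (p : I -> 'rV[R]_n) h (i0 : I) :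
  exists k g, (forall i, dotv h (p i) <= dotv h (p k)) /\
    forall i, p i != p k -> dotv g (p i) < dotv g (p k).
Proof.
have [k1 _ hk1] := @arg_maxP _ _ _ i0 xpredT (fun i => dotv h (p i)) isT.
have [k /eqP ek hk] := @arg_maxP _ _ _ k1
  (fun i => dotv h (p i) == dotv h (p k1)) (fun i => dotv (p i) (p i)) (eqxx _).
have hmax i : dotv h (p i) <= dotv h (p k) by rewrite ek; apply: hk1.
have [|M hM] := @finite_domination I (fun i => dotv h (p k) - dotv h (p i))
   (fun i => dotv (p k) (p i) - dotv (p k) (p k)).
  by move=> i; rewrite subr_ge0.
exists k, (M *: h + p k); split=> // i ik; rewrite !dotvDl !dotvZl.
have := hmax i; rewrite le_eqVlt => /orP[/eqP e|lt].
  (* Ties for [h] are broken by the Euclidean norm. *)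
  rewrite e ltrD2l.
  have := hk i; rewrite e ek eqxx => /(_ isT) hle.
  have : 0 < dotv (p i - p k) (p i - p k) by rewrite dotv_gt0 // subr_eq0.
  rewrite !dotvBr !(dotvC (_ - _)) !dotvBr (dotvC (p i) (p k)); move: hle => /=.
  lra.
have := hM i; rewrite subr_gt0 => /(_ lt); lra.
Qed.

Lemma affdim_row_free (A : set 'rV[R]_n) d d' v (B : 'M[R]_(d', n)) :
  affdim A d -> row_free B -> A v -> (forall i, A (v + row i B)) -> (d' <= d)%N.
Proof.
move=> [p [C [_ fC _ AC]]] fB Av AB.
have BC : (B <= C)%MS.
  apply/row_subP => i.
  have -> : row i B = (v + row i B - p) - (v - p).
    by rewrite opprB addrA subrK addrAC subrr add0r.
  by rewrite addmx_sub ?eqmx_opp ?AC.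
by have := mxrankS BC; rewrite (eqnP fB) (eqnP fC).
Qed.

End Functionals.

(** * Faces, vertices and edges of a convex hull *)

Section Hull.
Variables (R : realType) (n m : nat) (V : 'M[R]_(m, n)).
Implicit Types (w v x : 'rV[R]_n).
Notation P := (convex_hull_of V).

Lemma hull_row i : P (row i V).
Proof.
exists (fun j => (j == i)%:R); split=> [j||]; first by rewrite ler0n.
  by rewrite (bigD1 i) //= eqxx big1 ?addr0 // => j /negPf->.
rewrite (bigD1 i) //= eqxx scale1r big1 ?addr0 // => j /negPf->.
by rewrite scale0r.
Qed.

Lemma hull_convex x y (t : R) :
  0 <= t <= 1 -> P x -> P y -> P (t *: x + (1 - t) *: y).
Proof.
move=> /andP[t0 t1] [c [c0 c1 ->]] [d [d0 d1 ->]].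
exists (fun i => t * c i + (1 - t) * d i); split=> [i||].
- by rewrite addr_ge0 ?mulr_ge0 ?subr_ge0.
- by rewrite big_split -!mulr_sumr c1 d1 /=; ring.
- rewrite !scaler_sumr -big_split; apply: eq_bigr => i _ /=.
  by rewrite !scalerA scalerDl.
Qed.

Lemma hull_le w c :
  (forall i, dotv w (row i V) <= c) -> forall x, P x -> dotv w x <= c.
Proof.
move=> wc x [a [a0 a1 ->]].
rewrite dotv_sumr -[c]mul1r -a1 mulr_suml; apply: ler_sum => i _.
by rewrite dotvZr ler_wpM2l.
Qed.

(** Equality in a valid inequality forces equality at all the generators that
    occur in a convex combination. *)
Lemma hull_tight w c x : (forall i, dotv w (row i V) <= c) ->
  P x -> dotv w x = c ->
  exists a : 'I_m -> R, [/\ \sum_i a i = 1, x = \sum_i a i *: row i V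
    & forall i, a i != 0 -> dotv w (row i V) = c].
Proof.
move=> wc [a [a0 a1 xE]] wx; exists a; split=> // i ai.
have : \sum_i a i * (c - dotv w (row i V)) = 0.
  under eq_bigr => j _ do rewrite mulrBr.
  rewrite sumrB -mulr_suml a1 mul1r -wx xE dotv_sumr.
  under [X in _ - X]eq_bigr => j _ do rewrite -dotvZr.
  by rewrite subrr.
have ac j : true -> 0 <= a j * (c - dotv w (row j V)).
  by rewrite mulr_ge0 ?subr_ge0.
move=> /psumr_eq0P => /(_ ac) /(_ i isT) /eqP.
by rewrite mulf_eq0 (negPf ai) subr_eq0 /= => /eqP.
Qed.

Lemma exposed_row_vertex g k :
  (forall i, row i V != row k V -> dotv g (row i V) < dotv g (row k V)) ->
  vertex P (row k V).
Proof.
move=> gk; have gle i : dotv g (row i V) <= dotv g (row k V).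
  by case: (eqVneq (row i V) (row k V)) => [->//|/gk/ltW].
exists g, (dotv g (row k V)); split; first exact: hull_le.
apply/seteqP; split=> x /=; first by move=> ->; split=> //; apply: hull_row.
case=> Px gx; have [a [a1 -> atight]] := hull_tight gle Px gx.
rewrite -[RHS]scale1r -a1 scaler_suml; apply: eq_bigr => i _.
case: (eqVneq (a i) 0) => [->|/atight e]; first by rewrite !scale0r.
by case: (eqVneq (row i V) (row k V)) => [->//|/gk]; rewrite e ltxx.
Qed.

Lemma face_has_row w c x : (forall i, dotv w (row i V) <= c) ->
  P x -> dotv w x = c -> exists i, dotv w (row i V) = c.
Proof.
move=> wc Px wx; have [a [a1 _ tight]] := hull_tight wc Px wx.
apply: contrapT => none; have : \sum_i a i = 0.
  apply: big1 => i _; apply/eqP; case: eqVneq => // /tight e.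
  by case: none; exists i.
by rewrite a1 => /eqP; rewrite oner_eq0.
Qed.

Lemma face_has_vertex f : face P f -> f !=set0 -> exists2 v, vertex P v & f v.
Proof.
move=> [w [c [wc ->]]] [x [Px wx]].
have wV i : dotv w (row i V) <= c by apply: wc; apply: hull_row.
have [i0 i0c] := face_has_row wV Px wx.
have [k [g [hk gk]]] := exposed_maximizer (fun i => row i V) w i0.
exists (row k V); first exact: exposed_row_vertex gk.
split; first exact: hull_row.
by apply/eqP; rewrite eq_le wV -i0c hk.
Qed.

Lemma edge_line E v u : edge P E -> E v -> E (v + u) -> u != 0 ->
  forall x, E x -> exists s, x = v + s *: u.
Proof.
move=> [_ [p [B [_ _ _ EB]]]] Ev Eu u0 x Ex.
have inB y : E y -> (y - v <= B)%MS.
  move=> Ey; have -> : y - v = (y - p) - (v - p) by rewrite opprB addrA subrK.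
  by rewrite addmx_sub ?eqmx_opp ?EB.
have uB : (u <= B)%MS by have := inB _ Eu; rewrite addrAC subrr add0r.
have Bu : (B <= u)%MS.
  have /sub_rVP[s us] := uB.
  have s0 : s != 0 by apply: contraNneq u0 => s0; rewrite us s0 scale0r.
  by rewrite -[B](scalerK s0) -us scalemx_sub.
have /sub_rVP[s xs] := submx_trans (inB _ Ex) Bu.
by exists s; rewrite -xs addrC subrK.
Qed.

(** The far end of an edge is where the direction [u] is maximal on it: for
    large [M] the maximizers over [P] of [M] times the functional of the edge
    plus [u] lie on the edge, and one of them is a vertex of [P]. *)
Lemma edge_far_vertex E v u : edge P E -> E v -> E (v + u) -> u != 0 ->
  exists2 t, 0 < t & vertex P (v + t *: u) /\ E (v + t *: u).
Proof.
move=> eE Ev Eu u0; have line := edge_line eE Ev Eu u0.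
have [[w [c [wc EE]]] _] := eE.
have wV i : dotv w (row i V) <= c by apply: wc; apply: hull_row.
move: Ev Eu; rewrite EE => -[Pv wv] [Pu wu].
have [i0 i0c] := face_has_row wV Pv wv.
have [|M hM] := @finite_domination R _ (fun i => c - dotv w (row i V))
   (fun i => dotv u (row i V) - dotv u (row i0 V)).
  by move=> i; rewrite subr_ge0.
have [k [g [hk gk]]] := exposed_maximizer (fun i => row i V) (M *: w + u) i0.
have wk : dotv w (row k V) = c.
  apply/eqP; case: eqVneq => // wk.
  have := hM k; rewrite subr_gt0 lt_neqAle wk wV => /(_ isT).
  by have := hk i0; rewrite !dotvDl !dotvZl i0c; lra.
have Ek : E (row k V) by rewrite EE; split=> //; apply: hull_row.
have [t kt] := line _ Ek.
have t1 : 1 <= t.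
  have := hull_le hk Pu; rewrite !dotvDl !dotvZl wk wu lerD2l kt !dotvDr.
  by rewrite lerD2l dotvZr -[X in X <= _]mul1r ler_pM2r // dotv_gt0.
exists t; first exact: lt_le_trans t1.
by rewrite -kt -EE; split=> //; apply: exposed_row_vertex gk.
Qed.

(** The principle behind the simplex method: a vertex where no edge decreases
    [h] minimizes [h].  With [w] exposing [v], rescale the nonzero differences
    between generators and [v] to points [p l] of the hyperplane [w = -1]; an
    exposed point of the slice of the tangent cone that they span is an edge
    of [P], and one of these points minimizes [h] over the slice. *)
Lemma decreasing_edge v h x : vertex P v -> P x -> dotv h x < dotv h v ->
  exists E d, [/\ edge P E, E v, E (v + d) & dotv h d < 0].
Proof.
move=> [w [c [wc vE]]] Px hx.
have [Pv wv] : P v /\ dotv w v = c by have : [set v] v by []; rewrite vE.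
have [l0 hl0] : exists l, dotv h (row l V) < dotv h v.
  apply: contrapT => none; suff : dotv (- h) x <= dotv (- h) v.
    by rewrite !dotvNl lerN2 leNgt hx.
  apply: hull_le => // i; rewrite !dotvNl lerN2 leNgt; apply/negP => hi.
  by apply: none; exists i.
pose I := {l | row l V != v}.
have l0I : row l0 V != v by apply/eqP => e; rewrite e ltxx in hl0.
pose s (l : 'I_m) := c - dotv w (row l V).
have s_gt0 (l : I) : 0 < s (val l).
  have wl : dotv w (row (val l) V) <= c by apply: wc; apply: hull_row.
  rewrite subr_gt0 lt_neqAle wl andbT; apply/eqP => e.
  have /eqP := valP l; apply.
  by have : [set v] (row (val l) V) by rewrite vE; split=> //; apply: hull_row.
pose p (l : I) := (s (val l))^-1 *: (row (val l) V - v).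
have pK (l : I) : row (val l) V - v = s (val l) *: p l.
  by rewrite scalerA divff ?scale1r // gt_eqF.
have [k [g [hk gk]]] := exposed_maximizer p (- h) (Sub l0 l0I : I).
pose f := g + dotv g (p k) *: w.
pose E := [set x | P x /\ dotv f x = dotv f v].
have fI (l : I) : dotv f (row (val l) V) - dotv f v
    = s (val l) * (dotv g (p l) - dotv g (p k)).
  rewrite -dotvBr dotvDl dotvZl [X in dotv g X]pK dotvZr dotvBr wv /s; ring.
have fle l : dotv f (row l V) <= dotv f v.
  case: (eqVneq (row l V) v) => [->//|lI].
  rewrite -subr_le0 (fI (Sub l lI)) pmulr_rle0 ?s_gt0 // subr_le0.
  by case: (eqVneq (p (Sub l lI)) (p k)) => [->//|/gk/ltW].
have hkl : dotv h (row (val k) V - v) < 0.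
  rewrite pK dotvZr pmulr_rlt0 //.
  have := hk (Sub l0 l0I); rewrite !dotvNl lerN2 => /le_lt_trans; apply.
  rewrite dotvZr pmulr_rlt0 ?invr_gt0 ?(s_gt0 (Sub l0 l0I)) //.
  by rewrite dotvBr subr_lt0.
have Ek : E (v + (row (val k) V - v)).
  rewrite addrC subrK; split; first exact: hull_row.
  by apply/eqP; rewrite -subr_eq0 fI subrr mulr0.
exists E, (row (val k) V - v); split=> //; split.
  by exists f, (dotv f v); split=> //; apply: hull_le.
have d0 : row (val k) V - v != 0.
  by apply/eqP => e; rewrite e dotv0r ltxx in hkl.
exists v, (row (val k) V - v); split=> //.
- by rewrite -row_leq_rank lt0n mxrank_eq0.
- by move=> i; rewrite ord1 row_id.
move=> y [Py fy]; have [a [a1 -> tight]] := hull_tight fle Py fy.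
rewrite -[v in X in (X <= _)%MS]scale1r -a1 scaler_suml -sumrB.
apply: summx_sub => l _; rewrite -scalerBr.
have [->|al] := eqVneq (a l) 0; first by rewrite scale0r sub0mx.
apply: scalemx_sub; have [->|lI] := eqVneq (row l V) v.
  by rewrite subrr sub0mx.
have /eqP := tight l al; rewrite -subr_eq0 (fI (Sub l lI)) mulf_eq0.
rewrite gt_eqF ?s_gt0 //= subr_eq0 => /eqP e.
have {e} e : p (Sub l lI) = p k.
  by apply/eqP; apply: contraT => /gk; rewrite e ltxx.
by rewrite (pK (Sub l lI)) e scalemx_sub // /p scalemx_sub.
Qed.

End Hull.

(** * Integer vectors and lattice bases *)

Section IntegerVectors.
Variables (R : realType) (n : nat).
Implicit Types (u w : 'rV[int]_n) (U W : 'M[int]_n).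

Lemma zvecD u w : zvec R (u + w) = zvec R u + zvec R w.
Proof. exact: map_mxD. Qed.

Lemma zvecN u : zvec R (- u) = - zvec R u.
Proof. exact: map_mxN. Qed.

Lemma zvecZ (a : int) u : zvec R (a *: u) = a%:~R *: zvec R u.
Proof. exact: map_mxZ. Qed.

Lemma zvec_eq0 u : (zvec R u == 0) = (u == 0).
Proof.
apply/eqP/eqP => [/rowP h|->]; last exact: map_mx0.
by apply/rowP => i; have /eqP := h i; rewrite !mxE intr_eq0 => /eqP.
Qed.

Lemma dotv_zvec_row u U j :
  dotv (zvec R u) (zvec R (row j U)) = (\sum_i u 0 i * U j i)%:~R.
Proof.
rewrite (big_morph (fun a : int => a%:~R : R) (intrD R) (mulr0z 1)).
by apply: eq_bigr => i _; rewrite !mxE intrM.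
Qed.

Lemma primitive_scale u w (a : int) :
  primitive_zvec u -> u = a *: w -> absz a = 1%N.
Proof.
move=> pu ue; apply/eqP; rewrite -dvdn1 -pu; apply/dvdn_biggcdP => i _.
by rewrite ue mxE abszM dvdn_mulr.
Qed.

Lemma primitive_zvecN u : primitive_zvec u -> primitive_zvec (- u).
Proof.
rewrite /primitive_zvec => pu; rewrite -[RHS]pu.
by apply: eq_bigr => i _; rewrite mxE abszN.
Qed.

Lemma primitive_direction w : w != 0 ->
  exists u (g : nat), [/\ primitive_zvec u, (0 < g)%N & w = g%:Z *: u].
Proof.
move=> w0; pose g := \big[gcdn/0%N]_(i < n) absz (w 0 i).
have gd (i : 'I_n) : (g %| absz (w 0%R i))%N by apply: biggcdn_inf (dvdnn _).
have g0 : (0 < g)%N.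
  rewrite lt0n; apply: contraNneq w0 => g0; apply/eqP/rowP => i.
  by have := gd i; rewrite g0 dvd0n mxE absz_eq0 => /eqP.
have wE (i : 'I_n) : w 0 i = g%:Z * (w 0%R i %/ g%:Z)%Z.
  by rewrite mulrC divzK // dvdzE.
exists (\row_i (w 0%R i %/ g%:Z)%Z), g; split=> //; last first.
  by apply/rowP => i; rewrite !mxE -wE.
apply/eqP; rewrite /primitive_zvec -(eqn_pmul2l g0) muln1.
rewrite (big_morph (muln g) (muln_gcdr g) (muln0 g)); apply/eqP.
by apply: eq_bigr => i _; rewrite mxE [in RHS]wE abszM.
Qed.

Lemma primitive_neq0 u : primitive_zvec u -> u != 0.
Proof.
move=> pu; apply/eqP => u0.
have := primitive_scale pu (_ : u = 0 *: u); rewrite scale0r => /(_ u0).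
by rewrite absz0.
Qed.

Lemma sum_eq1_delta (I : finType) (a : I -> int) : (forall i, 0 <= a i) ->
  \sum_i a i = 1 -> exists k, a =1 (fun i => (i == k)%:Z).
Proof.
move=> a0 a1; have [k ak] : exists k, a k != 0.
  apply: contrapT => none; suff : \sum_i a i = 0 by rewrite a1.
  apply: big1 => i _; apply/eqP; case: eqVneq => // ai.
  by case: none; exists i.
have S0 : 0 <= \sum_(i | i != k) a i by apply: sumr_ge0.
move: a1; rewrite (bigD1 k) //= => a1.
have [ak1 S1] : a k = 1 /\ \sum_(i | i != k) a i = 0.
  by have := a0 k; move: (a k) (\sum_(i | _) a i) ak S0 a1 => b S; lia.
exists k => i; case: eqVneq => [->//|ik].
have /psumr_eq0P := S1.
by move=> /(_ (fun j _ => a0 j)); apply.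
Qed.

Lemma spanning_Zbasis U :
  (forall i, exists c : 'rV_n, delta_mx 0 i = c *m U) -> Zbasis U.
Proof.
move=> /choice[c cE].
have WU : (\matrix_i c i) *m U = 1%:M.
  by apply/row_matrixP => i; rewrite row_mul rowK -cE row1.
move=> w; exists (w *m \matrix_i c i); split.
  by rewrite -mulmx_sum_row -mulmxA WU mulmx1.
by move=> d ->; rewrite -mulmx_sum_row -mulmxA (mulmx1C WU) mulmx1.
Qed.

Lemma Zbasis_inverse U : Zbasis U -> exists W, W *m U = 1%:M.
Proof.
move=> bU; have /choice[c cE] : forall i,
    exists c : 'rV_n, delta_mx 0 i = c *m U.
  move=> i; have [c [cE _]] := bU (delta_mx 0 i).
  by exists c; rewrite mulmx_sum_row.
exists (\matrix_i c i).
by apply/row_matrixP => i; rewrite row_mul rowK -cE row1.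
Qed.

Definition dual_row W i : 'rV[int]_n := (col i W)^T.

Definition coord W i (x : 'rV[R]_n) : R := dotv (zvec R (dual_row W i)) x.

Lemma coordE W i x : coord W i x = (x *m map_mx intr W) 0 i.
Proof. by rewrite mxE; apply: eq_bigr => j _; rewrite !mxE mulrC. Qed.

Lemma coord_zvec_row W U i k :
  coord W i (zvec R (row k U)) = ((U *m W) k i)%:~R.
Proof. by rewrite coordE -map_mxM -row_mul !mxE. Qed.

Section Dual.
Variables (U W : 'M[int]_n).
Hypothesis WU : W *m U = 1%:M.

Lemma coord_row i j : coord W i (zvec R (row j U)) = (i == j)%:R.
Proof. by rewrite coord_zvec_row (mulmx1C WU) mxE eq_sym; case: (i == j). Qed.

Lemma coord_sum x : x = \sum_i coord W i x *: zvec R (row i U).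
Proof.
have -> : \sum_i coord W i x *: zvec R (row i U)
    = (x *m map_mx intr W) *m map_mx intr U.
  rewrite mulmx_sum_row; apply: eq_bigr => i _.
  by rewrite -coordE /zvec map_row.
by rewrite -mulmxA -map_mxM WU map_mx1 mulmx1.
Qed.

Lemma dotv_coord (w x : 'rV[R]_n) :
  dotv w x = \sum_i coord W i x * dotv w (zvec R (row i U)).
Proof.
by rewrite {1}(coord_sum x) dotv_sumr; apply: eq_bigr => i _; rewrite dotvZr.
Qed.

Lemma zvec_dual_sum u :
  u = \sum_i (\sum_j u 0 j * U i j) *: dual_row W i.
Proof.
rewrite -[LHS]mulmx1 -trmx1 -WU trmx_mul mulmxA mulmx_sum_row.
apply: eq_bigr => i _; congr (_ *: _); last by rewrite /dual_row tr_col.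
by rewrite mxE; apply: eq_bigr => j _; rewrite mxE.
Qed.

Definition other_edges (V : 'M[int]_n) (t : 'I_n -> R) i : 'M[R]_(n.-1, n) :=
  \matrix_(k < n.-1) (t (lift i k) *: zvec R (row (lift i k) V)).

Lemma other_edges_free (t : 'I_n -> R) i :
  (forall j, t j != 0) -> row_free (other_edges U t i).
Proof.
move=> t0; set B := other_edges _ _ _; apply/row_freeP.
exists (\matrix_(a < n, k < n.-1) ((t (lift i k))^-1 * (W a (lift i k))%:~R)).
apply/matrixP => k l; rewrite [LHS]mxE [RHS]mxE.
under eq_bigr => a _ do rewrite [X in _ * X]mxE mulrCA.
rewrite -mulr_sumr; have -> : \sum_a B k a * (W a (lift i l))%:~R
    = coord W (lift i l) (row k B).
  by rewrite coordE mxE; apply: eq_bigr => a _; rewrite !mxE.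
rewrite rowK /coord dotvZr -/(coord _ _ _) coord_row.
rewrite (inj_eq lift_inj) eq_sym; case: eqP => [->|_]; last by rewrite !mulr0.
by rewrite mulr1 mulVf.
Qed.

Lemma other_edges_span (t : 'I_n -> R) i x : (forall j, t j != 0) ->
  coord W i x = 0 -> (x <= other_edges U t i)%MS.
Proof.
move=> t0 xi; rewrite (coord_sum x); apply: summx_sub => j _.
case: (unliftP i j) => [k ->|->]; last by rewrite xi scale0r sub0mx.
apply: scalemx_sub; have -> : zvec R (row (lift i k) U)
    = (t (lift i k))^-1 *: row k (other_edges U t i) by rewrite rowK scalerK.
by rewrite scalemx_sub ?row_sub.
Qed.

End Dual.
End IntegerVectors.

(** * The corner of a monotone polytope at a vertex *)

Section Vertex.
Variables (R : realType) (n : nat) (P : set 'rV[R]_n).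
Implicit Types (v x : 'rV[R]_n) (u : 'rV[int]_n) (U W : 'M[int]_n).

Lemma edge_subset E x : edge P E -> E x -> P x.
Proof. by move=> [[w [c [_ ->]]] _] []. Qed.

Lemma vertex_in v : vertex P v -> P v.
Proof.
by move=> [w [c [_ e]]]; have : [set v] v by []; rewrite e => -[].
Qed.

Lemma primitive_edge_point v u : primitive_edge_vector P v u ->
  exists2 t : R, 0 < t & P (v + t *: zvec R u).
Proof.
by move=> [_ [E [eE _ [t t0 Et]]]]; exists t => //; apply: edge_subset Et.
Qed.

Lemma frame_edge_point v U i : edge_frame P v U ->
  exists2 t : R, 0 < t & P (v + t *: zvec R (row i U)).
Proof. by move=> [_ fU]; apply: primitive_edge_point; apply/fU; exists i. Qed.

Lemma edge_primitive_direction E v d : rational_edges P ->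
  edge P E -> E v -> E (v + d) -> d != 0 ->
  exists u t, [/\ primitive_edge_vector P v u, 0 < t & d = t *: zvec R u].
Proof.
move=> rP eE Ev Ed d0; have [w w0 wE] := rP E eE.
have [t] := wE _ _ Ev Ed; rewrite addrAC subrr add0r => dE.
have [u [g [pu g0 wg]]] := primitive_direction w0.
have main u' s : primitive_zvec u' -> 0 < s -> d = s *: zvec R u' ->
    exists u t, [/\ primitive_edge_vector P v u, 0 < t & d = t *: zvec R u].
  move=> pu' s0 de; exists u', s; split=> //; split=> //.
  by exists E; split=> //; exists s; rewrite -?de.
move: dE; rewrite wg zvecZ scalerA => dE.
have : t * g%:Z%:~R != 0 by apply: contraNneq d0 => e; rewrite dE e scale0r.
rewrite neq_lt => /orP[neg|pos]; last exact: main pos dE.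
apply: (main (- u) (- (t * g%:Z%:~R))).
- exact: primitive_zvecN.
- by rewrite oppr_gt0.
- by rewrite zvecN scalerN scaleNr opprK.
Qed.

Variables (m : nat) (V : 'M[R]_(m, n)).
Hypotheses (PV : P = convex_hull_of V) (ratP : rational_edges P).

Lemma polytope_in_corner v U W x i : vertex P v -> edge_frame P v U ->
  W *m U = 1%:M -> P x -> coord W i v <= coord W i x.
Proof.
move=> vv [_ fU] WU Px; rewrite leNgt; apply/negP => lt.
have [|||E [d []]] := @decreasing_edge _ _ _ V v (zvec R (dual_row W i)) x.
- by rewrite -PV.
- by rewrite -PV.
- by [].
rewrite -PV => eE Ev Ed dlt.
have d0 : d != 0 by apply: contraTneq dlt => ->; rewrite dotv0r ltxx.
have [u [t [/fU[j ->] t0 de]]] := edge_primitive_direction ratP eE Ev Ed d0.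
move: dlt; rewrite de dotvZr -/(coord W i _) (coord_row _ WU).
by rewrite ltNge mulr_ge0 ?ler0n // ltW.
Qed.

Lemma far_vertex v u : primitive_edge_vector P v u ->
  exists2 t, 0 < t & vertex P (v + t *: zvec R u)
    /\ primitive_edge_vector P (v + t *: zvec R u) (- u).
Proof.
move=> [pu [E [eE Ev [t t0 Et]]]].
have u0 : t *: zvec R u != 0.
  by rewrite scaler_eq0 zvec_eq0 negb_or gt_eqF ?primitive_neq0.
have [|s s0 []] := @edge_far_vertex _ _ _ V _ _ _ _ Ev Et u0; rewrite -PV //.
rewrite scalerA => vs Es; have st0 := mulr_gt0 s0 t0.
exists (s * t) => //; split=> //; split; first exact: primitive_zvecN.
exists E; split=> //; exists (s * t) => //.
by rewrite zvecN scalerN addrK.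
Qed.

(** The face where the [i]-th coordinate is minimal has dimension [n - 1], as
    it contains [v] and a further point of each of the other edges. *)
Lemma coordinate_facet v U W i : vertex P v -> edge_frame P v U ->
  W *m U = 1%:M -> facet P [set x | P x /\ coord W i x = coord W i v].
Proof.
move=> vv fU WU; split.
  exists (- zvec R (dual_row W i)), (- coord W i v); split=> [x Px|].
    by rewrite dotvNl lerN2; apply: polytope_in_corner vv fU WU Px.
  apply/seteqP; split=> x [Px e]; split=> //; first by rewrite dotvNl -e.
  by move: e; rewrite dotvNl => /oppr_inj.
have /choice[t tP] : forall j, exists t : R,
    0 < t /\ P (v + t *: zvec R (row j U)).
  by move=> j; have [t] := frame_edge_point j fU; exists t.
have t0 j := lt0r_neq0 (tP j).1.
exists n.-1; first by case: (n) (i) => [[]|].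
exists v, (other_edges U t i); split; first by split=> //; apply: vertex_in.
- exact: (other_edges_free WU i t0).
- move=> k; rewrite rowK; split; first exact: (tP _).2.
  rewrite /coord dotvDr dotvZr -!/(coord _ _ _).
  by rewrite (coord_row _ WU) (negPf (neq_lift _ _)) mulr0 addr0.
- move=> x [_ xi]; apply: (other_edges_span WU t0).
  by rewrite /coord dotvBr -!/(coord _ _ _) xi subrr.
Qed.

(** Reflexivity puts the [i]-th coordinate facet at lattice distance one from
    the origin.  Its normal kills the edges other than [i] and hence is an
    integer multiple of the dual vector; being primitive and exterior, it is
    minus the dual vector. *)
Lemma vertex_coord v U W i : reflexive_polytope P -> vertex P v ->
  edge_frame P v U -> W *m U = 1%:M -> coord W i v = -1.
Proof.
move=> [_ _ refl] vv fU WU.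
pose F := [set x | P x /\ coord W i x = coord W i v].
have [u pu [uP FE]] := refl F (coordinate_facet i vv fU WU).
have /choice[t tP] : forall j, exists t : R,
    0 < t /\ P (v + t *: zvec R (row j U)).
  by move=> j; have [t] := frame_edge_point j fU; exists t.
have Fj j : j != i -> F (v + t j *: zvec R (row j U)).
  move=> ji; split; first exact: (tP j).2.
  rewrite /coord dotvDr dotvZr -!/(coord _ _ _).
  by rewrite (coord_row _ WU) eq_sym (negPf ji) mulr0 addr0.
have Fv : F v by split=> //; apply: vertex_in.
have uv : dotv (zvec R u) v = 1 by move: Fv; rewrite FE => -[].
have uj j : j != i -> dotv (zvec R u) (zvec R (row j U)) = 0.
  move=> /Fj; rewrite FE => -[_]; rewrite dotvDr uv dotvZr => /eqP.
  rewrite -subr_eq0 addrAC subrr add0r mulf_eq0 gt_eqF ?(tP j).1 //=.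
  by move=> /eqP.
have ui : dotv (zvec R u) (zvec R (row i U)) <= 0.
  have := uP _ (tP i).2; rewrite dotvDr uv gerDl dotvZr pmulr_rle0 //.
  exact: (tP i).1.
pose a : int := \sum_j u 0 j * U i j.
have ua : dotv (zvec R u) (zvec R (row i U)) = a%:~R.
  exact: dotv_zvec_row.
have uE : u = a *: dual_row W i.
  rewrite [LHS](zvec_dual_sum WU) (bigD1 i) //= [X in _ + X]big1.
    by rewrite addr0.
  move=> j ji.
  have /eqP := uj j ji; rewrite dotv_zvec_row intr_eq0 => /eqP ->.
  by rewrite scale0r.
have aE : a = -1.
  have := primitive_scale pu uE; move: ui; rewrite ua lerz0.
  by case: (a) => [[|[]]|[]].
move: uv; rewrite uE aE zvecZ dotvZl mulN1r => /eqP.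
by rewrite eqr_oppLR => /eqP.
Qed.

End Vertex.

(** * Corner charts of deeply monotone polytopes *)

(** The local normal form of a monotone polytope: in the coordinates given by
    [W] it lies in the orthant with apex [v = (-1, ..., -1)], whose rays carry
    the edges at [v]. *)
Definition corner_chart (R : realType) n (P : set 'rV[R]_n) v U W :=
  [/\ W *m U = 1%:M, edge_frame P v U, v = - \sum_i zvec R (row i U)
    & forall x i, P x -> -1 <= coord W i x].

Section DeeplyMonotone.
Variables (R : realType) (n : nat) (P : set 'rV[R]_n).
Hypothesis hP : deeply_monotone P.
Implicit Types (v x y : 'rV[R]_n) (u : 'rV[int]_n) (U W : 'M[int]_n).

Lemma rational : rational_edges P.
Proof. by have [[[]]] := hP. Qed.

Lemma polytope_hull : exists m (V : 'M[R]_(m, n)), P = convex_hull_of V.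
Proof. by have [[_ [[]]]] := hP. Qed.

Lemma polytope_dim : affdim P n.
Proof. by have [[_ [[]]]] := hP. Qed.

Lemma polytope_convex x y (s : R) :
  0 <= s <= 1 -> P x -> P y -> P (s *: x + (1 - s) *: y).
Proof. by have [m [V ->]] := polytope_hull; apply: hull_convex. Qed.

Lemma nonempty_face_vertex f :
  face P f -> f !=set0 -> exists2 v, vertex P v & f v.
Proof. by have [m [V ->]] := polytope_hull; apply: face_has_vertex. Qed.

Lemma polytope_has_vertex : exists v, vertex P v.
Proof.
have [p [_ [Pp _ _ _]]] := polytope_dim.
have [||v vv _] := @nonempty_face_vertex P; [|by exists p|by exists v].
have d0 x : dotv 0 x = 0 :> R by rewrite dotvC dotv0r.
exists 0, 0; split=> [x _|]; first by rewrite d0.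
by apply/seteqP; split=> x // [].
Qed.

Lemma vertex_has_chart v : vertex P v -> exists U W, corner_chart P v U W.
Proof.
move=> vv; have [_ [[_ _ fr] refl]] := hP.
have [U [fU bU]] := fr v vv; have [W WU] := Zbasis_inverse bU.
have [m [V PV]] := polytope_hull.
have cv i := vertex_coord PV rational i refl vv fU WU.
exists U, W; split=> // [|x i Px].
  rewrite {1}(coord_sum WU v) -sumrN; apply: eq_bigr => i _.
  by rewrite (cv i) scaleN1r.
by rewrite -(cv i); exact: (polytope_in_corner PV rational i vv fU WU Px).
Qed.

Lemma chart_coord v U W i : corner_chart P v U W -> coord W i v = -1.
Proof.
move=> [WU _ -> _]; rewrite /coord dotvNr dotv_sumr (bigD1 i) //=.
rewrite -!/(coord _ _ _) (coord_row _ WU) eqxx big1 ?addr0 // => j ji.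
by rewrite -/(coord _ _ _) (coord_row _ WU) eq_sym (negPf ji).
Qed.

(** As [v] is minus the sum of all the edge vectors, adding to [v] those outside
    [e] leaves minus the sum of those in [e]. *)
Lemma chart_corner v U W (e : pred 'I_n) : vertex P v -> corner_chart P v U W ->
  P (- \sum_(i | e i) zvec R (row i U)).
Proof.
move=> vv [_ fU vE _]; have [[_ _ corner] _] := hP.
apply: (corner v vv); exists U, (fun i => (~~ e i)%:R); split=> //.
  by move=> i; case: (e i) => /=; rewrite ?lexx ler01.
have -> : v = - \sum_(i | e i) zvec R (row i U)
    - \sum_(i | ~~ e i) zvec R (row i U).
  by rewrite {1}vE (bigID e) opprD.
rewrite -addrA -[LHS]addr0; congr (_ + _).
rewrite [X in _ + X](bigID e) /= [X in _ + (X + _)]big1; last first.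
  by move=> i ->; rewrite scale0r.
rewrite add0r; under [X in _ + X]eq_bigr => i ei do rewrite ei scale1r.
by rewrite addNr.
Qed.

Lemma opp_edge_in v U W i : vertex P v -> corner_chart P v U W ->
  P (- zvec R (row i U)).
Proof.
move=> vv cU; have := chart_corner (pred1 i) vv cU.
by rewrite big_pred1_eq.
Qed.

Lemma chart_edge_point v U W i : corner_chart P v U W ->
  exists2 t : R, 0 < t & P (v + t *: zvec R (row i U)).
Proof. by move=> [_ fU _ _]; apply: frame_edge_point. Qed.

Lemma chart_facet v U W i : vertex P v -> corner_chart P v U W ->
  facet P [set x | P x /\ coord W i x = -1].
Proof.
move=> vv cU; have [WU fU _ _] := cU; have [m [V PV]] := polytope_hull.
rewrite -(chart_coord i cU).
exact: (coordinate_facet PV rational i vv fU WU).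
Qed.

Lemma far_chart v U W i : vertex P v -> corner_chart P v U W ->
  exists v' U' W' k (t : R), [/\ v' = v + t *: zvec R (row i U), vertex P v',
    corner_chart P v' U' W' & row k U' = - row i U].
Proof.
move=> vv [_ [_ fU] _ _]; have [m [V PV]] := polytope_hull.
have [|t t0 [v'v pe]] := @far_vertex _ _ _ _ _ PV v (row i U).
  by apply/fU; exists i.
have [U' [W' cU']] := vertex_has_chart v'v.
have [_ [_ fU'] _ _] := cU'; have [k kE] := (fU' _).1 pe.
by exists (v + t *: zvec R (row i U)), U', W', k, t.
Qed.

Lemma edge_in v U W i : vertex P v -> corner_chart P v U W ->
  P (zvec R (row i U)).
Proof.
move=> vv cU; have [v' [U' [W' [k [_ [_ vv' cU' e]]]]]] := far_chart i vv cU.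
by have := opp_edge_in k vv' cU'; rewrite e zvecN opprK.
Qed.

(** Evaluating at [v], minus the sum of the edge vectors [u_i], shows that the
    nonnegative integers [- u . u_i] add up to [1], so that a single one of them
    is nonzero and equals [1]. *)
Lemma supporting_functional v U W u : corner_chart P v U W ->
  (forall x, P x -> dotv (zvec R u) x <= 1) -> dotv (zvec R u) v = 1 ->
  exists k, forall x, dotv (zvec R u) x = - coord W k x.
Proof.
move=> cU uP uv; have [WU _ vE _] := cU.
pose a k := - \sum_j u 0 j * U k j.
have aE k : dotv (zvec R u) (zvec R (row k U)) = - (a k)%:~R.
  by rewrite dotv_zvec_row /a rmorphN opprK.
have a0 k : 0 <= a k.
  rewrite -(ler0z R) -oppr_le0 -aE.
  have [t t0 Pt] := chart_edge_point k cU.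
  by have := uP _ Pt; rewrite dotvDr uv gerDl dotvZr pmulr_rle0.
have a1 : \sum_k a k = 1.
  apply: (@intr_inj R); rewrite -[RHS]uv vE dotvNr dotv_sumr -sumrN.
  rewrite (big_morph (fun a : int => a%:~R : R) (intrD R) (mulr0z 1)).
  by apply: eq_bigr => k _; rewrite aE opprK.
have [k ak] := sum_eq1_delta a0 a1; exists k => x.
rewrite (dotv_coord WU) (bigD1 k) //= aE ak eqxx mulrN1 big1 ?addr0 //.
by move=> j jk; rewrite aE ak (negPf jk) oppr0 mulr0.
Qed.

(** Let [v'] be the far end of edge [i].  Each facet through [v] other than the
    [i]-th contains [v'], so by [supporting_functional] its coordinate at [v] is
    also one of the coordinates at [v'].  Thus the edges at [v'] are [- u_i]
    and [u_j + a_j u_i], and the corner at [v'] gives the three points. *)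
Lemma neighbour_edge v U W i j : vertex P v -> corner_chart P v U W -> i != j ->
  exists a : int,
    let w := zvec R (row j U) + a%:~R *: zvec R (row i U) in
    [/\ P w, P (- w) & P (zvec R (row i U) - w)].
Proof.
move=> vv cU ij; have [WU _ _ Pge] := cU.
have [v' [U' [W' [k0 [t [v'E vv' cU' k0E]]]]]] := far_chart i vv cU.
have [W'U' _ _ _] := cU'.
have facets l : l != i -> exists k, forall x, coord W l x = coord W' k x.
  move=> li.
  have [x Px||k kE] := @supporting_functional v' U' W' (- dual_row W l) cU'.
  - by rewrite zvecN dotvNl lerNl -/(coord _ _ _) Pge.
  - rewrite zvecN dotvNl v'E dotvDr dotvZr -!/(coord _ _ _).
    by rewrite (chart_coord _ cU) (coord_row _ WU) (negPf li) mulr0 addr0 opprK.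
  by exists k => x; apply: oppr_inj; rewrite -kE zvecN dotvNl.
have ji : j != i by rewrite eq_sym.
have [k kE] := facets j ji.
pose a := (U' *m W) k i; exists a => w.
have wE : zvec R (row k U') = w.
  rewrite (coord_sum WU (zvec R (row k U'))) (bigD1 j) //= (bigD1 i) //=.
  rewrite kE (coord_row _ W'U') eqxx scale1r coord_zvec_row big1 ?addr0 //.
  move=> l /andP[lj li]; have [kl klE] := facets l li.
  rewrite klE (coord_row _ W'U'); case: eqP => [e|_]; last by rewrite scale0r.
  have := coord_row R WU l j; rewrite klE e -kE (coord_row _ WU) eqxx.
  by rewrite (negPf lj) => /eqP; rewrite oner_eq0.
have kk0 : k != k0.
  apply/eqP => e; have := coord_row R WU j i.
  have := coord_row R W'U' k k; rewrite -kE {1}e k0E zvecN /coord dotvNr.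
  rewrite -/(coord _ _ _) => + e'; rewrite e' eqxx (negPf ji) oppr0 => /eqP.
  by rewrite eq_sym oner_eq0.
rewrite -wE; split; [exact: edge_in vv' cU' | exact: opp_edge_in vv' cU' |].
(* Minus the sum of the edge vectors [w] and [- u_i] at [v']. *)
have := chart_corner (pred2 k k0) vv' cU'.
rewrite (bigD1 k) /= ?eqxx // (bigD1 k0) /=; last first.
  by rewrite eqxx orbT eq_sym.
rewrite big1 ?addr0; last first.
  by move=> l /andP[/andP[/orP[]->]].
by rewrite k0E zvecN opprD opprK addrC.
Qed.

(** * The Ewald conditions *)

(** The Ewald set without the lattice condition: this part is convex. *)
Definition symmetric_point x := P x /\ P (- x).

Lemma symmetric_segment y x (a : int) : a != 0 ->
  symmetric_point y -> symmetric_point (y + a%:~R *: x) ->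
  symmetric_point (y + (sgz a)%:~R *: x).
Proof.
move=> a0; set b : R := a%:~R; set e : R := (sgz a)%:~R.
have [s s01 eE] : exists2 s : R, 0 <= s <= 1 & e = s * b.
  have b0 : b != 0 by rewrite intr_eq0.
  have b1 : 1 <= `|b| by rewrite -intr_norm ler1z; move: a0; lia.
  exists `|b|^-1; first by rewrite invr_ge0 normr_ge0 invf_le1 // normr_gt0.
  have eb : e = Num.sg b by rewrite sgrEz sgz_int.
  apply: (canRL (mulKf _)); first by rewrite normr_eq0.
  by rewrite eb mulrC -numEsg.
have comb (z z' : 'rV[R]_n) : z + e *: z' = s *: (z + b *: z') + (1 - s) *: z.
  by apply/rowP => l; rewrite !mxE eE; ring.
move=> [Py Ny] [Pyx Nyx]; split; first by rewrite comb; apply: polytope_convex.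
rewrite opprD -scalerN comb; apply: polytope_convex => //.
by rewrite scalerN -opprD.
Qed.

(** In the notation of [neighbour_edge], [u_j] and [u_j + a u_i] are symmetric
    points, so [a != 0] makes [u_j + u_i] or [u_j - u_i] one by convexity.  The
    same holds with [i] and [j] exchanged; if both numbers vanish, the third
    points of [neighbour_edge] are [u_i - u_j] and its opposite. *)
Lemma symmetric_pair v U W i j : vertex P v -> corner_chart P v U W -> i != j ->
  exists e : int, (e = 1 \/ e = -1) /\
    symmetric_point (- zvec R (row i U) + e%:~R *: zvec R (row j U)).
Proof.
move=> vv cU ij; have [a [a1 a2 a3]] := neighbour_edge vv cU ij.
rewrite eq_sym in ij; have [b [b1 b2 b3]] := neighbour_edge vv cU ij.
have sym k : symmetric_point (zvec R (row k U)).
  by split; [apply: edge_in vv cU | apply: opp_edge_in vv cU].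
have symN x : symmetric_point x -> symmetric_point (- x).
  by case=> p q; split; rewrite ?opprK.
have sg (c : int) : c != 0 -> sgz c = 1 \/ sgz c = -1.
  by case: sgzP => //; [left | right].
have [a0|a0] := eqVneq a 0; last first.
  have := symmetric_segment a0 (sym j) (conj a1 a2).
  case: (sg a a0) => -> s; [exists (-1) | exists 1]; split; auto.
    by have := symN _ s; rewrite scale1r scaleN1r opprD addrC.
  by move: s; rewrite scale1r scaleN1r addrC.
have [b0|b0] := eqVneq b 0; last first.
  have := symmetric_segment b0 (sym i) (conj b1 b2).
  move=> /symN; rewrite opprD -scaleNr -rmorphN => s.
  exists (- sgz b); split=> //.
  by case: (sg b b0) => ->; [right | left]; rewrite ?opprK.
exists 1; split; first by left.
move: a3 b3; rewrite a0 b0 !scale0r !addr0 => a3 b3.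
by rewrite scale1r; split; rewrite 1?addrC // opprB.
Qed.

Lemma Ewald_zvec u : symmetric_point (zvec R u) -> Ewald_set P (zvec R u).
Proof. by move=> [Pu Nu]; split=> //; split=> //; exists u. Qed.

Lemma chart_Ewald v U W i : vertex P v -> corner_chart P v U W ->
  Ewald_set P (zvec R (row i U)) /\ Ewald_set P (- zvec R (row i U)).
Proof.
move=> vv cU; have e := edge_in i vv cU; have o := opp_edge_in i vv cU.
split; first exact: Ewald_zvec.
by rewrite -zvecN; apply: Ewald_zvec; split; rewrite zvecN ?opprK.
Qed.

Lemma chart_Zbasis v U W : corner_chart P v U W -> Zbasis U.
Proof.
move=> [WU _ _ _]; apply: spanning_Zbasis => i; exists (row i W).
by rewrite -row_mul WU row1.
Qed.

Lemma deeply_monotone_weak_Ewald : weak_Ewald P.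
Proof.
have [v vv] := polytope_has_vertex; have [U [W cU]] := vertex_has_chart vv.
exists U; split=> [|i]; first exact: chart_Zbasis cU.
by case: (chart_Ewald i vv cU).
Qed.

(** A facet through [v] is [{x_k = -1}]; with the signs of [symmetric_pair],
    the lattice basis consists of [- u_k] and the points [- u_k + e_j u_j]. *)
Lemma deeply_monotone_strong_Ewald : strong_Ewald P.
Proof.
move=> F fF; have [faceF [d dn [p [_ [Fp _ _ _]]]]] := fF.
have [v vv Fv] := nonempty_face_vertex faceF (ex_intro _ p Fp).
have [U [W cU]] := vertex_has_chart vv; have [WU _ _ _] := cU.
have [_ [_ [_ _ refl]]] := hP; have [u pu [uP FE]] := refl F fF.
have [k kE] : exists k, forall x, dotv (zvec R u) x = - coord W k x.
  by apply: supporting_functional cU uP _; move: Fv; rewrite FE => -[].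
have /choice[e eP] : forall j, exists e : int,
   (j = k -> e = 0) /\ (j != k -> (e = 1 \/ e = -1)) /\
   symmetric_point (- zvec R (row k U) + e%:~R *: zvec R (row j U)).
  move=> j; have [->|jk] := eqVneq j k.
    exists 0; split=> //; split=> //; rewrite scale0r addr0.
    by split; rewrite ?opprK; [apply: opp_edge_in vv cU|apply: edge_in vv cU].
  have kj : k != j by rewrite eq_sym.
  have [e [e1 es]] := symmetric_pair vv cU kj.
  by exists e; split=> [e0|//]; rewrite e0 eqxx in jk.
(* [e k = 0], so the [k]-th row is [- u_k] itself. *)
pose B := \matrix_j (- row k U + e j *: row j U).
exists B; split.
  have spanU j : exists c : 'rV_n, row j U = c *m B.
    have Bk : - row k U = row k B by rewrite rowK (eP k).1 // scale0r addr0.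
    have [->|jk] := eqVneq j k.
      by exists (- delta_mx 0 k); rewrite mulNmx -rowE -Bk opprK.
    exists (e j *: (delta_mx 0 j - delta_mx 0 k)).
    rewrite -scalemxAl mulmxBl -!rowE -Bk rowK addrAC subrr add0r scalerA.
    by case: ((eP j).2.1 jk) => ->; rewrite scale1r.
  have /choice[c cE] := spanU.
  apply: spanning_Zbasis => i; exists (row i W *m \matrix_j c j).
  rewrite -mulmxA; have -> : (\matrix_j c j) *m B = U.
    by apply/row_matrixP => j; rewrite row_mul rowK -cE.
  by rewrite -row_mul WU row1.
move=> j; have BE : zvec R (row j B)
    = - zvec R (row k U) + (e j)%:~R *: zvec R (row j U).
  by rewrite rowK zvecD zvecN zvecZ.
have [e0 [_ es]] := eP j; split; first by apply: Ewald_zvec; rewrite BE.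
rewrite FE; split; first by rewrite BE; apply: es.1.
rewrite kE BE /coord dotvDr dotvNr dotvZr -!/(coord _ _ _) !(coord_row _ WU).
rewrite eqxx opprD opprK; case: eqP => [/esym/e0 ->|_].
  by rewrite mul0r subr0.
by rewrite mulr0 subr0.
Qed.

(** Going from [v] to [x] adds nonnegative multiples of the edge vectors, none
    of which increases [w]; as [w] does not decrease, each edge vector that
    occurs
    leaves [w] unchanged. *)
Lemma face_contains_edges v U W w c x i : corner_chart P v U W ->
  (forall y, P y -> dotv w y <= c) -> dotv w v = c ->
  dotv w x = c -> (forall j, -1 <= coord W j x) -> -1 < coord W i x ->
  dotv w (zvec R (row i U)) = 0.
Proof.
move=> cU wP wv wx xge xi; have [WU _ _ _] := cU.
have wU j : dotv w (zvec R (row j U)) <= 0.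
  have [t t0 Pt] := chart_edge_point j cU.
  by have := wP _ Pt; rewrite dotvDr wv gerDl dotvZr pmulr_rle0.
have cxv j : coord W j (x - v) = coord W j x + 1.
  by rewrite /coord dotvBr -!/(coord _ _ _) (chart_coord _ cU) opprK.
have S : \sum_j - (coord W j (x - v) * dotv w (zvec R (row j U))) = 0.
  by rewrite sumrN -dotv_coord // dotvBr wx wv subrr oppr0.
have S0 j : true -> 0 <= - (coord W j (x - v) * dotv w (zvec R (row j U))).
  move=> _; rewrite oppr_ge0 mulr_ge0_le0 // cxv.
  by have := xge j; lra.
have /eqP : - (coord W i (x - v) * dotv w (zvec R (row i U))) = 0.
  exact: (psumr_eq0P S0 S).
rewrite oppr_eq0 mulf_eq0 => /orP[|/eqP//].
by rewrite cxv gt_eqF //; move: xi; lra.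
Qed.

(** The functional that exposes [f] decreases along some edge [i] at a vertex
    [v] of [f], so that [f] is contained in the facet [{x_i = -1}].  The point
    [- u_i] has [i]-th coordinate [-1] and all others [0], so a face through [v]
    and [- u_i] contains the [n - 1] other edges and cannot be a ridge; a face
    through [v] and [u_i] contains all the edges, hence is [P]. *)
Lemma deeply_monotone_star_Ewald : star_Ewald P.
Proof.
move=> f ff f0 fP; have [v vv fv] := nonempty_face_vertex ff f0.
have [U [W cU]] := vertex_has_chart vv; have [WU _ _ Pge] := cU.
have [w [c [wP fE]]] := ff.
have wv : dotv w v = c by move: fv; rewrite fE => -[].
have free_edges w' x : (forall j, dotv w' (zvec R (row j U)) = 0) ->
    dotv w' x = dotv w' v.
  move=> w'0; rewrite (dotv_coord WU w' x) (dotv_coord WU w' v).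
  by apply: eq_bigr => j _; rewrite w'0 !mulr0.
have [i wi] : exists i, dotv w (zvec R (row i U)) != 0.
  apply: contrapT => none; apply: fP; rewrite fE; apply/seteqP.
  split=> [y []//|y Py]; split=> //; rewrite -wv; apply: free_edges => j.
  by apply/eqP; case: eqVneq => // wj; case: none; exists j.
pose F := [set x | P x /\ coord W i x = -1].
have fF : f `<=` F.
  move=> x; rewrite fE => -[Px wx]; split=> //; apply/eqP; rewrite eq_le Pge //.
  rewrite andbT leNgt; apply/negP => xi.
  by case/eqP: wi; apply: face_contains_edges cU wP wv wx _ xi => j; apply: Pge.
have [oin iin] : P (- zvec R (row i U)) /\ P (zvec R (row i U)).
  by split; [apply: opp_edge_in vv cU | apply: edge_in vv cU].
have cN j : coord W j (- zvec R (row i U)) = - (j == i)%:R.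
  by rewrite /coord dotvNr -/(coord _ _ _) (coord_row _ WU).
have edges j : exists t : R, 0 < t /\ P (v + t *: zvec R (row j U)).
  by have [t] := chart_edge_point j cU; exists t.
have /choice[t tP] := edges.
exists (- zvec R (row i U)); split.
- by case: (chart_Ewald i vv cU).
- split.
    exists F; last by split=> //; rewrite cN eqxx.
    by split=> //; apply: chart_facet vv cU.
  move=> [G [[[w' [c' [w'P GE]]] [d dn dG]] fG] Gi].
  have w'v : dotv w' v = c' by have := fG _ fv; rewrite GE => -[].
  have w'j j : j != i -> dotv w' (zvec R (row j U)) = 0.
    move=> ji; move: Gi; rewrite GE => -[_ w'i].
    apply: face_contains_edges cU w'P w'v w'i _ _.
      by move=> l; apply: Pge.
    by rewrite cN (negPf ji) oppr0 ltrN10.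
  (* [G] would contain [v] and a point of each of the other edges, so its
     dimension would be at least [n - 1]. *)
  have free := other_edges_free WU i (fun j => lt0r_neq0 (tP j).1).
  have := affdim_row_free dG free (fG _ fv).
  suff GB k : G (v + row k (other_edges U t i)).
    by move=> /(_ GB); rewrite -dn /= ltnn.
  rewrite rowK GE; split; first exact: (tP _).2.
  by rewrite dotvDr dotvZr w'v w'j ?mulr0 ?addr0 // eq_sym neq_lift.
- rewrite opprK => -[G [[[w' [c' [w'P GE]]] [d dn dG]] fG] Gi].
  have w'v : dotv w' v = c' by have := fG _ fv; rewrite GE => -[].
  have w'0 j : dotv w' (zvec R (row j U)) = 0.
    move: Gi; rewrite GE => -[_ w'i].
    apply: face_contains_edges cU w'P w'v w'i _ _.
      by move=> l; apply: Pge.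
    by rewrite (coord_row _ WU) (lt_le_trans (ltrN10 R)) // ler0n.
  (* [G] would be [P], whose dimension is [n]. *)
  have [p [B [Pp fB PB _]]] := polytope_dim.
  have GP x : P x -> G x.
    by move=> Px; rewrite GE; split=> //; rewrite (free_edges _ _ w'0).
  have := affdim_row_free dG fB (GP _ Pp) (fun l => GP _ (PB l)).
  by rewrite -dn ltnn.
Qed.

End DeeplyMonotone.

Theorem theorem2p1 (R : realType) (n : nat) (P : set 'rV[R]_n)
    (hP : deeply_monotone P) :
  strong_Ewald P /\ star_Ewald P /\ weak_Ewald P.
Proof.
split; first exact: deeply_monotone_strong_Ewald.
split; first exact: deeply_monotone_star_Ewald.
exact: deeply_monotone_weak_Ewald.
Qed.
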